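(* Let $k$ be a positive integer. There is an algorithm that, given a graph $G$ on $n$ vertices with $\Delta_G\le k\cdot(\log_2 n)^{1/3}$ and an induced complete bipartite subgraph $B$ of $G$, decides whether $B$ is generating in $O(n^{2+2k^3})$ time.
   Context: All graphs are finite, simple, undirected; $n=|V(G)|$ and $\Delta_G=\max\{|N(v)|:v\in V(G)\}$ is the maximum degree. An independent set is maximal if it is not properly contained in another independent set. An induced complete bipartite subgraph $B$ of $G$ with bipartition $B_X,B_Y$ is generating if there is an independent set $S$ of $G$ such that both $S\cup B_X$ and $S\cup B_Y$ are maximal independent sets of $G$. *)

(* Defs.v *)
From HB Require Import structures.
From mathcomp Require Import all_boot all_order all_algebra.
From mathcomp Require Import reals exp.
Set Implicit Arguments.
Unset Strict Implicit.
Unset Printing Implicit Defensive.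

(* A simple graph is a symmetric irreflexive relation on its vertex type. *)

Definition neighbours (T : finType) (e : rel T) (v : T) : {set T} :=
  [set w | e v w].

Definition max_degree (T : finType) (e : rel T) : nat :=
  \max_(v : T) #|neighbours e v|.

Definition independent (T : finType) (e : rel T) (A : {set T}) : bool :=
  [forall x in A, forall y in A, ~~ e x y].

Definition maximal_independent (T : finType) (e : rel T) (A : {set T}) : bool :=
  maxset (independent e) A.

(* The subgraph of e induced by BX :|: BY is complete bipartite with
   bipartition (BX, BY).  Empty parts are not excluded. *)
Definition induced_complete_bipartite (T : finType) (e : rel T)
    (BX BY : {set T}) : bool :=
  [&& [disjoint BX & BY], independent e BX, independent e BY
    & [forall x in BX, forall y in BY, e x y]].

Definition generating (T : finType) (e : rel T) (BX BY : {set T}) : bool :=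
  [exists S : {set T}, [&& independent e S,
     maximal_independent e (S :|: BX) & maximal_independent e (S :|: BY)]].

Definition log2 (R : realType) (x : R) : R := (ln x / ln 2)%R.

(* Model of computation: structured programs for a uniform-cost random access
   machine whose registers and memory cells hold natural numbers.  The only
   arithmetic operations are addition and truncated subtraction, so that unit
   cost is legitimate: t steps of such a machine are simulated by a Turing
   machine in time polynomial in t and the input length. *)

Inductive expr : Type :=
  | Num of nat
  | Reg of nat
  | Mem of expr
  | Plus of expr & expr
  | Minus of expr & expr.

Inductive cmd : Type :=
  | Skip
  | Assign of nat & expr
  | Write of expr & expr
  | Seq of cmd & cmd
  | If of expr & cmd & cmd
  | While of expr & cmd.

Record state : Type := State { regs : nat -> nat; mem : nat -> nat }.

Definition upd (f : nat -> nat) (a v : nat) : nat -> nat :=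
  fun b => if b == a then v else f b.

Fixpoint eval (s : state) (x : expr) : nat :=
  match x with
  | Num c => c
  | Reg r => regs s r
  | Mem a => mem s (eval s a)
  | Plus a b => eval s a + eval s b
  | Minus a b => eval s a - eval s b
  end.

Fixpoint cost (x : expr) : nat :=
  match x with
  | Num _ | Reg _ => 1
  | Mem a => (cost a).+1
  | Plus a b | Minus a b => (cost a + cost b).+1
  end.

(* exec c s s' t: started in s, the program c halts in s' after t steps.
   Tests succeed on nonzero values. *)
Inductive exec : cmd -> state -> state -> nat -> Prop :=
  | ExecSkip s : exec Skip s s 1
  | ExecAssign s r x :
      exec (Assign r x) s (State (upd (regs s) r (eval s x)) (mem s))
        (cost x).+1
  | ExecWrite s a x :
      exec (Write a x) s (State (regs s) (upd (mem s) (eval s a) (eval s x)))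
        (cost a + cost x).+1
  | ExecSeq c1 c2 s1 s2 s3 t1 t2 :
      exec c1 s1 s2 t1 -> exec c2 s2 s3 t2 -> exec (Seq c1 c2) s1 s3 (t1 + t2)
  | ExecIfTrue x c1 c2 s s' t :
      eval s x != 0 -> exec c1 s s' t -> exec (If x c1 c2) s s' (cost x + t).+1
  | ExecIfFalse x c1 c2 s s' t :
      eval s x = 0 -> exec c2 s s' t -> exec (If x c1 c2) s s' (cost x + t).+1
  | ExecWhileTrue x c s1 s2 s3 t1 t2 :
      eval s1 x != 0 -> exec c s1 s2 t1 -> exec (While x c) s2 s3 t2 ->
      exec (While x c) s1 s3 (cost x + t1 + t2).+1
  | ExecWhileFalse x c s :
      eval s x = 0 -> exec (While x c) s s (cost x).+1.

Lemma exec_det c s s1 s2 t1 t2 :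
  exec c s s1 t1 -> exec c s s2 t2 -> s1 = s2 /\ t1 = t2.
Proof.
move=> H; elim: H s2 t2 => {c s s1 t1}.
- by move=> s s2 t2 H; inversion H.
- by move=> s r x s2 t2 H; inversion H.
- by move=> s a x s2 t2 H; inversion H.
- move=> c1 c2 s s' s'' t1 t2 _ IH1 _ IH2 s2 t H.
  inversion H as [| | |? ? ? r2 ? ? ? E1 E2| | | |]; subst.
  have [? ?] := IH1 _ _ E1; subst.
  by have [? ?] := IH2 _ _ E2; subst.
- move=> x c1 c2 s s' t Hx _ IH s2 t2 H.
  inversion H as [| | | |? ? ? ? ? ? Ex E|? ? ? ? ? ? Ex E| |]; subst.
    by have [-> ->] := IH _ _ E.
  by rewrite Ex in Hx.
- move=> x c1 c2 s s' t Hx _ IH s2 t2 H.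
  inversion H as [| | | |? ? ? ? ? ? Ex E|? ? ? ? ? ? Ex E| |]; subst.
    by rewrite Hx in Ex.
  by have [-> ->] := IH _ _ E.
- move=> x c s s' s'' t1 t2 Hx _ IH1 _ IH2 s2 t H.
  inversion H as [| | | | | |? ? ? r2 ? ? ? Ex E1 E2|? ? ? Ex]; subst.
    have [? ?] := IH1 _ _ E1; subst.
    by have [-> ->] := IH2 _ _ E2.
  by rewrite Ex in Hx.
- move=> x c s Hx s2 t2 H.
  inversion H as [| | | | | |? ? ? ? ? ? ? Ex E1 E2|? ? ? Ex]; subst => //.
  by rewrite Hx in Ex.
Qed.

(* Initially register 0 holds n, the memory holds the adjacency matrix of e in
   row-major order followed by the characteristic vector of B, and all other
   registers and cells are zero.  Only the vertex set of the subgraph is given,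
   not its bipartition. *)
Definition initial_state (n : nat) (e : rel 'I_n) (B : {set 'I_n}) : state :=
  State (upd (fun=> 0) 0 n)
    (nth 0 ([seq nat_of_bool (e i j) | i <- enum 'I_n, j <- enum 'I_n]
              ++ [seq nat_of_bool (i \in B) | i <- enum 'I_n])).

(* Main.v *)
Require Import Defs.
From HB Require Import structures.
From mathcomp Require Import all_boot all_order all_algebra.
From mathcomp Require Import reals exp.
From mathcomp Require Import zify.
Set Implicit Arguments.
Unset Strict Implicit.
Unset Printing Implicit Defensive.

(* If one part of B is empty, then B is independent and hence generating.
   Otherwise a witness S only has to dominate the vertices outside B that are
   adjacent to exactly one part, and the vertices of S that do this lie at
   distance two from B.  Conversely, an independent set of vertices at distance
   two that dominates them extends, among the vertices not adjacent to B, to a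
   witness.  With d the maximum degree, each part of B has at most d elements, so
   there are at most 2 d ^ 3 vertices at distance two; a binary counter runs
   through their subsets, and every subset is tested in O(n ^ 2) steps.  The
   degree hypothesis is exactly 2 ^ (2 d ^ 3) <= n ^ (2 k ^ 3). *)

(** * Generating subgraphs and the shell at distance two *)

Definition hood (T : finType) (e : rel T) (A : {set T}) : {set T} :=
  [set v | [exists u in A, e v u]].

Definition shell (T : finType) (e : rel T) (A : {set T}) : {set T} :=
  hood e (hood e A) :\: hood e A.

Definition one_sided (T : finType) (e : rel T) (X Y : {set T}) : {set T} :=
  [set v | (v \notin X :|: Y) && ((v \in hood e X) (+) (v \in hood e Y))].

Section Graph.

Context (T : finType) (e : rel T).
Implicit Types (A B S X Y : {set T}) (u v x y : T).

Lemma hoodP A v : reflect (exists2 u, u \in A & e v u) (v \in hood e A).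
Proof. by rewrite inE; apply: exists_inP. Qed.

Lemma hoodU A B : hood e (A :|: B) = hood e A :|: hood e B.
Proof.
apply/setP=> v; rewrite in_setU; apply/hoodP/orP.
  by case=> u /setUP[uA|uB] evu; [left|right]; apply/hoodP; exists u.
by case=> /hoodP[u uA evu]; exists u => //; rewrite inE uA ?orbT.
Qed.

Lemma hoodS A B : A \subset B -> hood e A \subset hood e B.
Proof.
by move=> /subsetP AB; apply/subsetP=> v /hoodP[u /AB uB euv]; apply/hoodP; exists u.
Qed.

Lemma one_sidedC X Y : one_sided e X Y = one_sided e Y X.
Proof. by apply/setP=> v; rewrite !inE addbC orbC. Qed.

Lemma independentP A :
  reflect {in A &, forall x y, ~~ e x y} (independent e A).
Proof.
apply: (iffP forall_inP) => [h x y xA yA|h x xA].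
  by move/forall_inP: (h x xA); apply.
by apply/forall_inP=> y yA; apply: h.
Qed.

Lemma independentS A B : A \subset B -> independent e B -> independent e A.
Proof.
move=> /subsetP AB /independentP h; apply/independentP=> x y /AB xB /AB yB.
exact: h.
Qed.

Hypothesis sym : symmetric e.
Hypothesis irr : irreflexive e.

Lemma card_hood A : #|hood e A| <= #|A| * max_degree e.
Proof.
have -> : hood e A = \bigcup_(u in A) neighbours e u.
  apply/setP=> v; apply/hoodP/bigcupP => -[u uA].
    by move=> evu; exists u; rewrite // inE sym.
  by rewrite inE sym => evu; exists u.
rewrite -sum_nat_const.
apply: (@leq_trans (\sum_(u in A) #|neighbours e u|)); last first.
  by apply: leq_sum => u _; apply: leq_bigmax.
apply: (big_rec2 (fun (s : {set T}) m => #|s| <= m)) => [|u m s _ le].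
  by rewrite cards0.
by apply: leq_trans (leq_card_setU _ _) _; rewrite leq_add2l.
Qed.

Lemma disjoint_hood A : independent e A = [disjoint A & hood e A].
Proof.
apply/independentP/pred0P => [h x|h x y xA yA].
  apply/negbTE/negP=> /andP[/= xA /hoodP[u uA exu]].
  by move: (h x u xA uA); rewrite exu.
apply/negP=> exy; move: (h x) => /= /negbT/negP; apply.
by rewrite xA; apply/hoodP; exists y.
Qed.

(** Only one-vertex extensions matter: a vertex without neighbours in [A] could be added, and one
    with a neighbour in [A] lies in no independent superset. *)
Lemma maximal_independentP A :
  reflect (independent e A /\ ~: A \subset hood e A) (maximal_independent e A).
Proof.
apply: (iffP maxsetP) => -[iA mA]; split=> //.
  apply/subsetP=> v; rewrite inE => vA; apply/negPn/negP=> vNA.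
  suff /mA/(_ (subsetUr _ _)) E : independent e (v |: A).
    by move: vA; rewrite -E setU11.
  apply/independentP=> x y /setU1P[->|xA] /setU1P[->|yA].
  - by rewrite irr.
  - by apply: contra vNA => evy; apply/hoodP; exists y.
  - by rewrite sym; apply: contra vNA => evx; apply/hoodP; exists x.
  - by move/independentP: iA; apply.
move=> B iB AB; apply/eqP; rewrite eqEsubset AB andbT.
apply/subsetP=> v vB; apply/negPn/negP=> vA.
have /hoodP[u uA evu] : v \in hood e A by apply: (subsetP mA); rewrite inE.
by move/independentP: iB => /(_ v u vB (subsetP AB u uA)); rewrite evu.
Qed.

Lemma independentU A B :
  independent e A -> independent e B -> [disjoint A & hood e B] ->
  independent e (A :|: B).
Proof.
move=> /independentP iA /independentP iB /pred0P dAB.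
have h x y : x \in A -> y \in B -> ~~ e x y.
  move=> xA yB; apply/negP=> exy; move: (dAB x) => /= /negbT/negP; apply.
  by rewrite xA; apply/hoodP; exists y.
apply/independentP=> x y /setUP[xA|xB] /setUP[yA|yB]; auto.
by rewrite sym; auto.
Qed.

Lemma generatingC X Y : generating e X Y = generating e Y X.
Proof. by apply: eq_existsb => S; rewrite [X in _ && X]andbC. Qed.

(* If BX is empty, a maximal independent set containing BY is a witness. *)
Lemma generating_empty Y : independent e Y -> generating e set0 Y.
Proof.
move=> iY; have [S mS YS] := maxset_exists iY.
apply/existsP; exists S.
by rewrite setU0 (setUidPl YS) /maximal_independent mS (maxsetp mS).
Qed.

Section NonEmpty.

Context (X Y : {set T}).
Hypothesis XY : induced_complete_bipartite e X Y.
Hypothesis X0 : X != set0.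
Hypothesis Y0 : Y != set0.

Lemma bipartite_adj x y : x \in X -> y \in Y -> e x y.
Proof. by case/and4P: XY => _ _ _ /forall_inP h /h/forall_inP; apply. Qed.

Lemma bipartite_hoodl : X \subset hood e Y.
Proof.
by have [y yY] := set0Pn _ Y0; apply/subsetP=> x xX; apply/hoodP; exists y;
  rewrite ?bipartite_adj.
Qed.

Lemma bipartite_hoodr : Y \subset hood e X.
Proof.
by have [x xX] := set0Pn _ X0; apply/subsetP=> y yY; apply/hoodP; exists x;
  rewrite // sym bipartite_adj.
Qed.

Lemma max_degree_partl : #|X| <= max_degree e.
Proof.
have [y yY] := set0Pn _ Y0.
apply: leq_trans (leq_bigmax y).
by apply/subset_leq_card/subsetP=> x xX; rewrite inE sym bipartite_adj.
Qed.

Lemma max_degree_partr : #|Y| <= max_degree e.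
Proof.
have [x xX] := set0Pn _ X0.
apply: leq_trans (leq_bigmax x).
by apply/subset_leq_card/subsetP=> y yY; rewrite inE bipartite_adj.
Qed.

(** Each part lies in the neighbourhood of any vertex of the other, so [X :|: Y] has at most twice
    the maximum degree many vertices. Each application of [hood] contributes one more factor. *)
Lemma card_shell : #|shell e (X :|: Y)| <= 2 * max_degree e ^ 3.
Proof.
apply: leq_trans (subset_leq_card (subsetDl _ _)) _.
apply: leq_trans (card_hood _) _.
rewrite [_ ^ 3]expnSr mulnA leq_mul2r; apply/orP; right.
apply: leq_trans (card_hood _) _.
rewrite [_ ^ 2]expnSr mulnA leq_mul2r; apply/orP; right.
apply: leq_trans (leq_card_setU _ _) _.
by rewrite expn1 mul2n -addnn leq_add ?max_degree_partl ?max_degree_partr.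
Qed.

(* Outside X and Y, only the vertices seen by exactly one of them still have to
   be dominated by S, and every such dominator lies at distance two. *)
Lemma generatingE :
  generating e X Y =
  [exists S : {set T}, [&& S \subset shell e (X :|: Y), independent e S
                         & one_sided e X Y \subset hood e S]].
Proof.
have /and4P[_ iX iY _] := XY.
apply/existsP/existsP => -[S /and3P[]]; last first.
  move=> SN iS domS.
  (* The witness is [S] extended to a maximal [M] among the independent sets with no vertex adjacent
     to [X :|: Y]. *)
  pose P (A : {set T}) :=
    independent e A && [disjoint A & hood e (X :|: Y)].
  have PS : P S.
    rewrite /P iS; apply/pred0P=> v /=; apply/negbTE/negP=> /andP[/(subsetP SN)].
    by rewrite inE => /andP[/negbTE->].
  have [M /maxsetP[/andP[iM dM] maxM] SM] := maxset_exists PS.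
  exists M; rewrite iM /=.
  have free v : v \notin M -> v \notin hood e (X :|: Y) -> v \in hood e M.
    move=> vM vN; apply/negPn/negP=> vNM.
    suff /maxM/(_ (subsetUr _ _)) E : P (v |: M).
      by move: vM; rewrite -E setU11.
    rewrite /P; apply/andP; split.
      rewrite setUC; apply: independentU => //.
        by apply/independentP=> x y /set1P-> /set1P->; rewrite irr.
      apply/pred0P=> u /=; apply/negbTE/negP=> /andP[uM /hoodP[w /set1P->]].
      by rewrite sym => evu; move/hoodP: vNM; apply; exists u.
    apply/pred0P=> u /=; apply/negbTE/negP=> /andP[/setU1P[->|uM]].
      by rewrite (negbTE vN).
    by move=> uN; move/pred0P: dM => /(_ u) /=; rewrite uM uN.
  (* This serves both parts. A vertex outside [M :|: U] is adjacent to [U], or not adjacent to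
     [X :|: Y] and then dominated by [free], or adjacent to [V] alone and then dominated by [S]. *)
  have side (U V : {set T}) : independent e U -> U \subset X :|: Y ->
      V \subset hood e U -> X :|: Y = U :|: V -> one_sided e U V \subset hood e S ->
      maximal_independent e (M :|: U).
    move=> iU UXY VU eq_XY dom; apply/maximal_independentP; split.
      by apply: independentU => //; apply: disjointWr (hoodS UXY) _.
    apply/subsetP=> v; rewrite in_setC in_setU negb_or => /andP[vM vU].
    rewrite hoodU in_setU.
    have [//|vNU] := boolP (v \in hood e U); first by rewrite orbT.
    rewrite orbF.
    have [vN|] := boolP (v \in hood e (X :|: Y)); last exact: free.
    have vV : v \notin V by apply: contra vNU => /(subsetP VU).
    apply: (subsetP (hoodS SM)); apply: (subsetP dom).
    rewrite in_set in_setU negb_or vU vV (negbTE vNU) /=.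
    by move: vN; rewrite eq_XY hoodU in_setU (negbTE vNU).
  rewrite (side X Y) ?subsetUl ?bipartite_hoodr //=.
  by rewrite (side Y X) ?subsetUr ?bipartite_hoodl 1?setUC // one_sidedC.
move=> iS /maximal_independentP[iSX mSX] /maximal_independentP[iSY mSY].
have noadj U v u : independent e (S :|: U) -> u \in S -> v \in U -> e u v = false.
  move=> /independentP i uS vU; apply/negbTE/i; rewrite inE ?uS ?vU ?orbT //.
have far u : u \in S -> u \notin hood e (X :|: Y).
  move=> uS; apply/hoodP=> -[v /setUP[vX|vY]].
    by rewrite (noadj X).
  by rewrite (noadj Y).
exists (S :&: shell e (X :|: Y)); apply/and3P; split; first exact: subsetIr.
  exact: independentS (subsetIl _ _) iS.
(* A vertex [v] seen by [U] but not by [V] must get its neighbour in the maximal set [S :|: V] from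
   [S]. That neighbour reaches [X :|: Y] through [v] and is not adjacent to it by [far], so it lies
   in the shell. *)
have side (U V : {set T}) v : independent e (S :|: U) ->
    ~: (S :|: V) \subset hood e (S :|: V) -> v \in hood e (X :|: Y) ->
    v \notin V -> v \in hood e U -> v \notin hood e V ->
    v \in hood e (S :&: shell e (X :|: Y)).
  move=> iU mV vN vV vU vNV.
  have vS : v \notin S.
    by apply/negP=> vS; case/hoodP: vU => u uU; rewrite (noadj U).
  have : v \in hood e (S :|: V).
    by apply: (subsetP mV); rewrite in_setC in_setU negb_or vS.
  rewrite hoodU in_setU (negbTE vNV) orbF => /hoodP[u uS evu].
  apply/hoodP; exists u => //; rewrite inE uS inE far //=.
  by apply/hoodP; exists v; rewrite // sym.
apply/subsetP=> v; rewrite inE in_setU negb_or => /andP[/andP[vX vY]].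
have [vNX|vNX] := boolP (v \in hood e X).
  rewrite addTb; apply: (side X Y v) => //.
  by rewrite hoodU in_setU vNX.
rewrite addFb => vNY; apply: (side Y X v) => //.
by rewrite hoodU in_setU vNY orbT.
Qed.

End NonEmpty.
End Graph.

(** * From the logarithmic degree bound to powers of [n] *)

Section Real.
Import Order.TTheory GRing.Theory Num.Theory.
Local Open Scope ring_scope.

(** Cubing the hypothesis removes the cube root and bounds [d ^ 3] by [k ^ 3] times [log2 n];
    doubling and exponentiating to base 2 gives the claim. *)
Lemma exp2_degree_bound (R : realType) (k n d : nat) : (0 < n)%N ->
  d%:R <= k%:R * log2 (n%:R : R) `^ (1 / 3) ->
  (2 ^ (2 * d ^ 3) <= n ^ (2 * k ^ 3))%N.
Proof.
move=> n0 hd.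
have ln2 : 0 < ln (2 : R) by rewrite ln_gt0 // ltr1n.
have log0 : 0 <= log2 (n%:R : R).
  by rewrite divr_ge0 ?(ltW ln2) // ln_ge0 // ler1n.
have cube : log2 (n%:R : R) `^ (1 / 3) ^+ 3 = log2 (n%:R : R).
  by rewrite -powR_mulrn ?powR_ge0 // -powRrM mul1r mulVf ?pnatr_eq0 // powRr1.
have : d%:R ^+ 3 <= (k%:R * log2 (n%:R : R) `^ (1 / 3)) ^+ 3.
  by rewrite lerXn2r ?nnegrE ?mulr_ge0 ?powR_ge0.
rewrite exprMn cube mulrA ler_pdivlMr // -!natrX !mulr_natl => d3.
have -> : (2 ^ (2 * d ^ 3) <= n ^ (2 * k ^ 3))%N =
    (2 ^+ (2 * d ^ 3) <= n%:R ^+ (2 * k ^ 3) :> R) by rewrite -!natrX ler_nat.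
rewrite -ler_ln ?posrE ?exprn_gt0 ?ltr0n // !lnXn ?ltr0n //.
by rewrite !(mulnC 2%N) (mulrnA _ (d ^ 3)) (mulrnA _ (k ^ 3)) lerMn2r.
Qed.

End Real.

(** * Cost-aware execution rules *)

(* Import of MathComp shadows the names mem, Num and Mem of Defs. *)
Local Notation cells := Defs.mem.
Local Notation Lit := Defs.Num.
Local Notation Cell := Defs.Mem.

(** Total correctness with an upper bound on time. Exact step counts are hidden so that bounds can
    be rounded up when they are composed. *)
Definition run (c : cmd) (s : state) (t : nat) (Q : state -> Prop) : Prop :=
  exists s' t', [/\ exec c s s' t', t' <= t & Q s'].

Lemma run_weaken c s t t' (Q Q' : state -> Prop) :
  run c s t Q -> t <= t' -> (forall s', Q s' -> Q' s') -> run c s t' Q'.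
Proof.
move=> [s' [t'' [E le Qs]]] le' QQ; exists s', t''; split=> //; last exact: QQ.
exact: leq_trans le le'.
Qed.

Lemma run_le c s t t' Q : run c s t Q -> t <= t' -> run c s t' Q.
Proof. by move=> h le; apply: run_weaken h le _. Qed.

Lemma run_seq c1 c2 s t1 t2 Q :
  run c1 s t1 (fun s' => run c2 s' t2 Q) -> run (Seq c1 c2) s (t1 + t2) Q.
Proof.
move=> [s1 [u1 [E1 le1 [s2 [u2 [E2 le2 Qs]]]]]]; exists s2, (u1 + u2).
by split; rewrite ?leq_add //; apply: ExecSeq E1 E2.
Qed.

Lemma run_seq_le c1 c2 s t1 t2 t (P Q : state -> Prop) :
  run c1 s t1 P -> (forall s', P s' -> run c2 s' t2 Q) -> t1 + t2 <= t ->
  run (Seq c1 c2) s t Q.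
Proof.
move=> h1 h2 le; apply: (@run_weaken _ _ (t1 + t2) _ Q) => //; apply: run_seq.
exact: run_weaken h1 (leqnn _) h2.
Qed.

Lemma run_if x (b : bool) c1 c2 s t Q :
  eval s x = b -> (b -> run c1 s t Q) -> (~~ b -> run c2 s t Q) ->
  run (If x c1 c2) s (cost x + t).+1 Q.
Proof.
case: b => Ex h1 h2.
  have [s' [u [E le Qs]]] := h1 isT; exists s', (cost x + u).+1.
  by split; rewrite ?ltnS ?leq_add2l //; apply: ExecIfTrue; rewrite ?Ex.
have [s' [u [E le Qs]]] := h2 isT; exists s', (cost x + u).+1.
by split; rewrite ?ltnS ?leq_add2l //; apply: ExecIfFalse; rewrite ?Ex.
Qed.

(** The index of the invariant is the exact number of iterations left, which yields termination as
    well as the time; the last summand pays for the failing test. *)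
Lemma run_while x c T (I : nat -> state -> Prop) Q m s :
  (forall s, I 0 s -> eval s x = 0 /\ Q s) ->
  (forall m s, I m.+1 s -> eval s x != 0 /\ run c s T (I m)) ->
  I m s -> run (While x c) s (m * (cost x + T).+1 + (cost x).+1) Q.
Proof.
move=> h0 hS; elim: m s => [|m IHm] s Is.
  by have [Ex Qs] := h0 s Is; exists s, (cost x).+1; split=> //; apply: ExecWhileFalse.
have [Ex [s1 [u1 [E1 le1 /IHm[s2 [u2 [E2 le2 Qs]]]]]]] := hS m s Is.
exists s2, (cost x + u1 + u2).+1; split=> //; last lia.
exact: ExecWhileTrue E1 E2.
Qed.

(* Loop-free commands are executed by a function, so that their effect can be
   computed by simplification. *)
Fixpoint loop_free (c : cmd) : bool :=
  match c with
  | Seq c1 c2 | If _ c1 c2 => loop_free c1 && loop_free c2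
  | While _ _ => false
  | _ => true
  end.

Fixpoint effect (c : cmd) (s : state) : state :=
  match c with
  | Skip | While _ _ => s
  | Assign r x => State (upd (regs s) r (eval s x)) (cells s)
  | Write a x => State (regs s) (upd (cells s) (eval s a) (eval s x))
  | Seq c1 c2 => effect c2 (effect c1 s)
  | If x c1 c2 => if eval s x != 0 then effect c1 s else effect c2 s
  end.

Lemma effect_if x c1 c2 s (b : bool) : eval s x = b ->
  effect (If x c1 c2) s = if b then effect c1 s else effect c2 s.
Proof. by move=> /= ->; case: b. Qed.

(** An upper bound for loop-free commands: a conditional is charged for both branches. The value at
    [While] is a dummy. *)
Fixpoint time (c : cmd) : nat :=
  match c with
  | Skip | While _ _ => 1
  | Assign r x => (cost x).+1
  | Write a x => (cost a + cost x).+1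
  | Seq c1 c2 => time c1 + time c2
  | If x c1 c2 => (cost x + (time c1 + time c2)).+1
  end.

Lemma run_loop_free c s (Q : state -> Prop) :
  loop_free c -> Q (effect c s) -> run c s (time c) Q.
Proof.
move=> lf Qs; exists (effect c s).
suff [t E le] : exists2 t, exec c s (effect c s) t & t <= time c by exists t.
elim: c s lf {Qs} => //=.
- by move=> s _; exists 1 => //; apply: ExecSkip.
- by move=> r x s _; exists (cost x).+1 => //; apply: ExecAssign.
- by move=> a x s _; exists (cost a + cost x).+1 => //; apply: ExecWrite.
- move=> c1 IH1 c2 IH2 s /andP[/IH1-/(_ s)[t1 E1 le1] /IH2-/(_ (effect c1 s))[t2 E2 le2]].
  by exists (t1 + t2); rewrite ?leq_add //; apply: ExecSeq E1 E2.
- move=> x c1 IH1 c2 IH2 s /andP[/IH1-/(_ s)[t1 E1 le1] /IH2-/(_ s)[t2 E2 le2]].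
  case: ifPn => Ex.
    by exists (cost x + t1).+1; [apply: ExecIfTrue|lia].
  by exists (cost x + t2).+1; [apply: ExecIfFalse => //; apply/eqP; rewrite -[_ == _]negbK|lia].
Qed.

Definition For (r : nat) (c : cmd) : cmd :=
  Seq (Assign r (Lit 0))
    (While (Minus (Reg 0) (Reg r)) (Seq c (Assign r (Plus (Reg r) (Lit 1))))).

(** The increment of the counter is built into the rule: the body only has to preserve register [r]
    and establish the next invariant for the state with [r] already advanced. *)
Lemma run_for r c T n (I : nat -> state -> Prop) (Q : state -> Prop) s :
  0 < n ->
  I 0 (State (upd (regs s) r 0) (cells s)) ->
  (forall i s, I i s -> regs s 0 = n /\ regs s r = i) ->
  (forall i s, i < n -> I i s -> run c s T (fun s' =>
     regs s' r = i /\ I i.+1 (State (upd (regs s') r i.+1) (cells s')))) ->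
  (forall s, I n s -> Q s) ->
  run (For r c) s ((T + 20) * n) Q.
Proof.
move=> n0 I0 Ireg Ibody IQ.
(* [run_while] counts iterations left, the invariant [I] those done. The constant 20 below also
   absorbs the cost of initialization and of the last test, because [n] is positive. *)
pose J m s := exists i, [/\ m + i = n & I i s].
apply: (@run_le _ _ (2 + (n * (3 + (T + 4)).+1 + 4))); last by nia.
apply: run_seq; exists (State (upd (regs s) r 0) (cells s)), 2; split=> //.
  exact: ExecAssign.
apply: (@run_while _ _ _ J); last by exists 0; rewrite addn0.
  move=> s' [i []]; rewrite add0n => -> Is; split; last exact: IQ.
  by have [/= -> ->] := Ireg _ _ Is; rewrite subnn.
move=> m s' [i [mi Is]]; split.
  by have [/= -> ->] := Ireg _ _ Is; rewrite subn_eq0 -ltnNge; lia.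
apply: run_seq; apply: run_weaken (leqnn _) _; first by apply: (Ibody i) => //; lia.
move=> s1 [Er Is1]; apply: run_loop_free => //=.
by exists i.+1; rewrite Er addn1; split=> //; lia.
Qed.

(** On the values 0 and 1, truncated subtraction supplies the Boolean connectives; the double
    negation in [Or] caps the sum at 1. *)
Definition Not x := Minus (Lit 1) x.
Definition And x y := Minus (Plus x y) (Lit 1).
Definition Or x y := Not (Not (Plus x y)).

Lemma eval_not s x (a : bool) : eval s x = a -> eval s (Not x) = ~~ a.
Proof. by rewrite /= => ->; case: a. Qed.

Lemma eval_and s x y (a b : bool) :
  eval s x = a -> eval s y = b -> eval s (And x y) = a && b.
Proof. by rewrite /= => -> ->; case: a; case: b. Qed.

Lemma eval_or s x y (a b : bool) :
  eval s x = a -> eval s y = b -> eval s (Or x y) = a || b.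
Proof. by rewrite /= => -> ->; case: a; case: b. Qed.

Definition agree (l : seq nat) (s s' : state) : Prop :=
  forall r, r \notin l -> regs s' r = regs s r.

Lemma agree_upd l s f r v m :
  r \in l -> agree l s (State f m) -> agree l s (State (upd f r v) m).
Proof.
move=> rl A r' hr'; rewrite /= /upd; case: eqP => [E|_]; last exact: A.
by rewrite E rl in hr'.
Qed.

Lemma has_iotaS (q : pred nat) j : has q (iota 0 j.+1) = has q (iota 0 j) || q j.
Proof. by rewrite -addn1 iotaD has_cat /= orbF. Qed.

Lemma all_iotaS (q : pred nat) j : all q (iota 0 j.+1) = all q (iota 0 j) && q j.
Proof. by rewrite -addn1 iotaD all_cat /= andbT. Qed.

(** * Memory layout and row-by-row passes over the adjacency matrix *)

(* Register usage: 0 holds n; 1 and 2 are the row and column counters i and j,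
   and 3 the address i * n + j of the current adjacency entry; register 4 + k
   holds the base address of the k-th array of length n. *)
Definition Adj := Cell (Reg 3).
Definition Arr k r := Cell (Plus (Reg (4 + k)) (Reg r)).

Definition env (n : nat) (adj : rel nat) (arr : nat -> nat -> bool) (s : state) :=
  [/\ regs s 0 = n,
      forall k, k < 5 -> regs s (4 + k) = n * n + k * n,
      forall i j, i < n -> j < n -> cells s (i * n + j) = adj i j
    & forall k i, i < n -> cells s (n * n + k * n + i) = arr k i].

Definition set_arr (arr : nat -> nat -> bool) k f : nat -> nat -> bool :=
  fun k' => if k' == k then f else arr k'.

Lemma row_major_inj n i j i' j' :
  j < n -> j' < n -> i * n + j = i' * n + j' -> i = i' /\ j = j'.
Proof.
move=> jn jn' E; have n0 : 0 < n by lia.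
suff Ei : i = i' by split=> //; move: E; rewrite Ei; lia.
by have := congr1 (divn^~ n) E; rewrite !divnMDl // !divn_small ?addn0.
Qed.

Section Env.

Context (n : nat) (adj : rel nat).
Hypothesis n0 : 0 < n.
Implicit Types (arr : nat -> nat -> bool) (s : state).

Lemma env_ext arr arr' s :
  (forall k i, i < n -> arr k i = arr' k i) -> env n adj arr s -> env n adj arr' s.
Proof. by move=> E [? ? ? h]; split=> // k i i_n; rewrite -E ?h. Qed.

Lemma env_agree arr l s s' :
  agree l s s' -> all (fun r => r \notin l) [:: 0; 4; 5; 6; 7; 8] ->
  cells s' = cells s -> env n adj arr s -> env n adj arr s'.
Proof.
move=> A /allP L Em [e0 eb ea er]; split; rewrite ?Em //.
  by rewrite A ?L.
move=> k k5; rewrite A ?eb // L //.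
by move: k k5; do 5?[case=> //].
Qed.

Lemma env_reg arr f m r v :
  r \notin [:: 0; 4; 5; 6; 7; 8] ->
  env n adj arr (State f m) -> env n adj arr (State (upd f r v) m).
Proof.
move=> hr; apply: (env_agree (l := [:: r])) => //.
  by apply: agree_upd; rewrite ?mem_head.
apply/allP=> r' hr'; rewrite inE; apply/eqP=> E.
by move: hr; rewrite -E hr'.
Qed.

(** The new content is a whole function [f], free to differ from the old one only at [i], so that
    callers can give it in closed form. All array cells lie beyond the matrix, and distinct entries
    have distinct addresses by [row_major_inj]. *)
Lemma env_write arr s k i (b : bool) f : i < n -> k < 5 ->
  f i = b -> (forall i', i' < n -> i' != i -> f i' = arr k i') ->
  env n adj arr s ->
  env n adj (set_arr arr k f)
    (State (regs s) (upd (cells s) (n * n + k * n + i) b)).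
Proof.
move=> i_n k5 fi fo [e0 eb ea er]; split=> //=.
  move=> i' j' i'n j'n; rewrite /upd ifN ?ea //.
  have : i'.+1 * n <= n * n by rewrite leq_mul2r i'n orbT.
  by rewrite mulSn; lia.
move=> k' i' i'n; rewrite /upd /set_arr.
case: eqVneq => [E|NE].
  have Ek : k' * n + i' = k * n + i by lia.
  have [-> ->] := row_major_inj i'n i_n Ek.
  by rewrite eqxx fi.
rewrite er //; case: eqP => // Ek; rewrite -Ek in fo *.
by rewrite fo //; apply: contraNneq NE => ->; rewrite Ek.
Qed.

Lemma eval_adj arr s i j : env n adj arr s -> i < n -> j < n ->
  regs s 3 = i * n + j -> eval s Adj = adj i j.
Proof. by move=> [_ _ ea _] i_n j_n /= ->; apply: ea. Qed.

Lemma eval_arr arr s k r i : env n adj arr s -> k < 5 -> i < n ->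
  regs s r = i -> eval s (Arr k r) = arr k i.
Proof. by move=> [_ eb _ er] k5 i_n /= ->; rewrite eb // er. Qed.

(* Register 13 records whether c holds for some entry of the current row. *)
Definition Scan (c : expr) : cmd :=
  Seq (Assign 13 (Lit 0))
    (For 2 (Seq (If c (Assign 13 (Lit 1)) Skip) (Assign 3 (Plus (Reg 3) (Lit 1))))).

Lemma run_scan c arr s i (q : pred nat) :
  env n adj arr s -> regs s 3 = i * n ->
  (forall s' j, j < n -> cells s' = cells s -> agree [:: 2; 3; 13] s s' ->
     regs s' 2 = j -> regs s' 3 = i * n + j -> eval s' c = q j) ->
  run (Scan c) s ((cost c + 40) * n) (fun s' =>
    [/\ cells s' = cells s, agree [:: 2; 3; 13] s s', regs s' 3 = i * n + n
      & regs s' 13 = has q (iota 0 n)]).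
Proof.
move=> [e0 _ _ _] e3 ec.
apply: (@run_le _ _ (2 + (cost c + 8 + 20) * n)); last by nia.
apply: run_seq; apply: run_loop_free => //=.
pose I j s' := [/\ cells s' = cells s, agree [:: 2; 3; 13] s s',
  regs s' 2 = j, regs s' 3 = i * n + j & regs s' 13 = has q (iota 0 j)].
apply: (@run_for _ _ _ n I) => //.
- split=> //=; last by rewrite /upd /= e3 addn0.
  by do 2!apply: agree_upd => //.
- by move=> j s' [_ A ? _ _]; rewrite A.
- move=> j s' jn [Em A e2 e3' e13].
  set body := Seq _ _; apply: (@run_le _ _ (time body)); last by rewrite /=; lia.
  apply: run_loop_free => //=.
  rewrite (ec _ j) //; case: (boolP (q j)) => qj; (split; first by rewrite /= /upd /= e2);
    split; rewrite ?has_iotaS ?(negbTE qj) ?qj ?orbT ?orbF //=;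
    by [do !apply: agree_upd => // | rewrite /upd /= ?e3' addn1 addnS | rewrite /upd /= e13].
- by move=> s' [].
Qed.

Definition Rows (c : expr) (post : cmd) : cmd :=
  Seq (Assign 3 (Lit 0)) (For 1 (Seq (Scan c) post)).

(** The arrays [arrs i] are those met at row [i], as [post] may write to memory. The invariant [J]
    has to survive changes of the four registers used by the loops. *)
Lemma run_rows c post arrs s (q : nat -> pred nat) (J : nat -> state -> Prop) :
  loop_free post ->
  (forall i s, J i s -> env n adj (arrs i) s) ->
  (forall i s s', agree [:: 1; 2; 3; 13] s s' -> cells s' = cells s -> J i s -> J i s') ->
  (forall i j s, i < n -> j < n -> J i s -> env n adj (arrs i) s ->
     regs s 1 = i -> regs s 2 = j -> regs s 3 = i * n + j -> eval s c = q i j) ->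
  (forall i s, i < n -> J i s -> env n adj (arrs i) s -> regs s 1 = i ->
     regs s 3 = i.+1 * n -> regs s 13 = has (q i) (iota 0 n) ->
     [/\ J i.+1 (effect post s), regs (effect post s) 1 = i
       & regs (effect post s) 3 = i.+1 * n]) ->
  J 0 s ->
  run (Rows c post) s ((cost c + time post + 80) * n * n) (J n).
Proof.
move=> lf Jenv Jagree Jc Jpost J0.
have ag r v (s' : state) : r \in [:: 1; 2; 3; 13] ->
    agree [:: 1; 2; 3; 13] s' (State (upd (regs s') r v) (cells s')).
  by move=> hr; apply: agree_upd.
apply: (@run_le _ _ (2 + ((cost c + 40) * n + time post + 20) * n)); last by nia.
apply: run_seq; apply: run_loop_free => //=.
pose I i s' := [/\ J i s', regs s' 1 = i & regs s' 3 = i * n].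
apply: (@run_for _ _ _ n I) => //.
- split=> //.
  by apply: (Jagree _ _ _ (ag 1 0 _ _)) => //; apply: (Jagree _ _ _ (ag 3 0 _ _)).
- by move=> i s' [/Jenv[]].
- move=> i s' i_n [Js e1 e3]; have Es := Jenv _ _ Js.
  have sub s1 : agree [:: 2; 3; 13] s' s1 -> agree [:: 1; 2; 3; 13] s' s1.
    by move=> A r; rewrite inE negb_or => /andP[_]; apply: A.
  apply: run_seq; apply: run_weaken (leqnn _) _.
    apply: (run_scan Es e3 (q := q i)) => s1 j jn Em A e2 e3'.
    have Js1 := Jagree _ _ _ (sub _ A) Em Js.
    by apply: Jc (Jenv _ _ Js1) _ _ _ => //; rewrite A.
  move=> s1 [Em A e3' e13]; apply: run_loop_free => //=.
  have Js1 := Jagree _ _ _ (sub _ A) Em Js.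
  have [|||h1 h2 h3] := Jpost _ _ i_n Js1 (Jenv _ _ Js1) => //; first by rewrite A.
    by rewrite e3' mulSn addnC.
  split=> //; split=> //.
  exact: (Jagree _ _ _ (ag 1 _ _ _)).
- by move=> s' [].
Qed.

Definition Mark k c := Rows c (Write (Plus (Reg (4 + k)) (Reg 1)) (Reg 13)).

(** Array [k] is overwritten during the pass, so the test must be correct whatever content [f] it
    has. *)
Lemma run_mark k c arr s (q : nat -> pred nat) : k < 5 ->
  env n adj arr s ->
  (forall i j f s', i < n -> j < n -> env n adj (set_arr arr k f) s' ->
     (forall r, 8 < r -> r != 13 -> regs s' r = regs s r) ->
     regs s' 1 = i -> regs s' 2 = j -> regs s' 3 = i * n + j ->
     eval s' c = q i j) ->
  run (Mark k c) s ((cost c + 90) * n * n) (fun s' =>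
    env n adj (set_arr arr k (fun i => has (q i) (iota 0 n))) s'
    /\ (forall r, 8 < r -> r != 13 -> regs s' r = regs s r)).
Proof.
move=> k5 Es ec.
(* Entries below [i] are new, the others still old. *)
pose arrs i := set_arr arr k
  (fun l => if l < i then has (q l) (iota 0 n) else arr k l).
pose J i s' := env n adj (arrs i) s'
  /\ (forall r, 8 < r -> r != 13 -> regs s' r = regs s r).
apply: (@run_weaken _ _ ((cost c + 5 + 80) * n * n) _ (J n)); [|by nia|]; last first.
  move=> s' [Es' A]; split=> //; apply: env_ext Es' => k' i i_n.
  by rewrite /arrs /set_arr; case: eqP; rewrite ?i_n.
apply: (@run_rows _ _ arrs s q J) => //.
- by move=> i s' [].
- move=> i s1 s2 A Em [E1 A1]; split; first exact: env_agree A _ Em E1.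
  move=> r r8 r13; rewrite A ?A1 // !inE !negb_or r13 andbT.
  by do !(apply/andP; split); apply/eqP; lia.
- by move=> i j s' i_n jn [_ A] Es' *; apply: ec Es' A _ _ _.
- move=> i s' i_n [_ A] Es' e1 e3 e13; split=> //=.
  split=> //=; case: (Es') => _ eb _ _; rewrite eb // e1 e13.
  have := env_write i_n k5 (b := has (q i) (iota 0 n))
    (f := fun l => if l < i.+1 then has (q l) (iota 0 n) else arr k l) _ _ Es'.
  move=> /(_ _ _)/env_ext; apply.
  + by move=> k' i' i'n; rewrite /arrs /set_arr; case: eqP.
  + by rewrite ltnSn.
  + by move=> i' i'n ne; rewrite /arrs /set_arr eqxx ltnS leq_eqVlt (negbTE ne).
- split=> //; apply: env_ext Es => k' i i_n.
  by rewrite /arrs /set_arr; case: eqP => // ->.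
Qed.

(** * Subsets as values of a binary counter *)

(* A subset S of M is read as a binary number: the elements of M are the digit
   positions, in increasing order, and place M i is the weight of position i. *)
Definition place (M : pred nat) i := 2 ^ (\sum_(l < i) M l).

Definition value (M S : pred nat) i := \sum_(l < i) (M l && S l) * place M l.

Lemma placeS M i : place M i.+1 = place M i + M i * place M i.
Proof.
rewrite /place big_ord_recr expnD /=.
by case: (M i); rewrite ?expn1 ?expn0; lia.
Qed.

Lemma place_gt0 M i : 0 < place M i.
Proof. by rewrite expn_gt0. Qed.

Lemma valueS M S i : value M S i.+1 = value M S i + (M i && S i) * place M i.
Proof. by rewrite /value big_ord_recr. Qed.

Lemma value_lt M S i : value M S i < place M i.
Proof.
elim: i => [|i IHi]; first by rewrite /value big_ord0 place_gt0.
rewrite valueS placeS; case: (M i) => /=; last lia.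
by case: (S i); lia.
Qed.

(** Uniqueness of binary expansions: by [value_lt] the lower digits add up to less than the weight
    of the top digit, which is therefore determined. Positions outside [M] agree because both sets
    lie in [M]. *)
Lemma value_inj M S T i : subpred S M -> subpred T M ->
  value M S i = value M T i -> forall l, l < i -> S l = T l.
Proof.
move=> SM TM; elim: i => [//|i IHi]; rewrite !valueS => E.
have ltS := value_lt M S i; have ltT := value_lt M T i.
have Ei : S i = T i.
  have [Mi|nMi] := boolP (M i).
    by move: E; rewrite Mi /=; case: (S i); case: (T i) => //=; lia.
  by rewrite (negbTE (contra (SM i) nMi)) (negbTE (contra (TM i) nMi)).
move=> l; rewrite ltnS leq_eqVlt => /orP[/eqP->//|]; apply: IHi.
by move: E; rewrite Ei; lia.
Qed.

(** Ripple-carry addition of 1 with the carry in register 14; only the positions marked in array 3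
    act as digits. *)
Definition Incr : cmd :=
  Seq (Assign 14 (Lit 1))
    (For 1 (If (And (Reg 14) (Arr 3 1))
      (If (Arr 4 1) (Write (Plus (Reg 8) (Reg 1)) (Lit 0))
        (Seq (Write (Plus (Reg 8) (Reg 1)) (Lit 1)) (Assign 14 (Lit 0))))
      Skip)).

(** The loop invariant is the final equation for the digits processed so far. By [value_lt], a carry
    left at the end means that [S] had the largest possible value and that the counter has wrapped
    around to 0. *)
Lemma run_incr arr s (S : pred nat) : subpred S (arr 3) ->
  env n adj (set_arr arr 4 S) s ->
  run Incr s (100 * n) (fun s' => exists (S' : pred nat) (c : bool),
    [/\ env n adj (set_arr arr 4 S') s', subpred S' (arr 3),
      agree [:: 1; 14] s s', regs s' 14 = c
    & value (arr 3) S' n + c * place (arr 3) n = (value (arr 3) S n).+1]).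
Proof.
move=> SM Es.
apply: (@run_le _ _ (2 + (40 + 20) * n)); last by nia.
apply: run_seq; apply: run_loop_free => //=.
pose I i s' := exists (S' : pred nat) (c : bool),
  [/\ [/\ env n adj (set_arr arr 4 S') s', subpred S' (arr 3) & agree [:: 1; 14] s s'],
    regs s' 1 = i, regs s' 14 = c, forall l, i <= l -> S' l = S l
  & value (arr 3) S' i + c * place (arr 3) i = (value (arr 3) S i).+1].
apply: (@run_for _ _ _ n I) => //.
- exists S, true; split=> //; last by rewrite /value /place !big_ord0.
  by split=> //; [do 2!apply: env_reg => // | do 2!apply: agree_upd => //].
- by move=> i s' [S' [c [[[? _ _ _] _ _] ? _ _ _]]].
- move=> i s' i_n [S' [c [[Es' SM' A] e1 e14 S'S vS]]].
  set body := If _ _ _; apply: (@run_le _ _ (time body)); last by rewrite /=; lia.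
  have b8 : regs s' 8 = n * n + 4 * n by case: Es' => _ /(_ 4 isT).
  apply: run_loop_free => //; rewrite /body.
  have eM : eval s' (And (Reg 14) (Arr 3 1)) = c && (arr 3) i.
    by apply: eval_and; [exact: e14|apply: (eval_arr Es' _ i_n e1)].
  have eS : eval s' (Arr 4 1) = S' i by apply: (eval_arr Es' _ i_n e1).
  have write b : env n adj (set_arr arr 4 (fun l => if l == i then b else S' l))
      (State (regs s') (upd (cells s') (n * n + 4 * n + i) (nat_of_bool b))).
    apply: (@env_ext (set_arr (set_arr arr 4 S') 4 (fun l => if l == i then b else S' l))).
      by move=> k l _; rewrite /set_arr; case: eqP.
    by apply: env_write Es' => //; [rewrite eqxx | move=> l _ /negbTE->].
  have vS' b : value (arr 3) (fun l => if l == i then b else S' l) i = value (arr 3) S' i.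
    by apply: eq_bigr => l _; rewrite ltn_eqF.
  rewrite (effect_if _ _ eM); case: (boolP (c && (arr 3) i)) => [/andP[c1 Mi]|ncM].
    rewrite (effect_if _ _ eS).
    have SiE := S'S i (leqnn i).
    case: (boolP (S' i)) => Si; rewrite /= b8 e1; (split; first by []).
      exists (fun l => if l == i then false else S' l), true; split=> //=.
      + split; [exact/env_reg/write|by move=> l /=; case: eqP => // _; apply: SM'|].
        by apply: agree_upd.
      + by rewrite /upd /= e14 c1.
      + by move=> l il; rewrite gtn_eqF //; apply: S'S; apply: ltnW.
      + rewrite !valueS vS' eqxx /= placeS -SiE Si Mi /=; move: vS; rewrite c1; lia.
    exists (fun l => if l == i then true else S' l), false; split=> //=.
    + split; [do 2!apply: env_reg => //; exact: write| |].
        by move=> l /=; case: eqP => [->//|_]; apply: SM'.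
      by do 2!apply: agree_upd => //.
    + by move=> l il; rewrite gtn_eqF //; apply: S'S; apply: ltnW.
    + rewrite !valueS vS' eqxx /= -SiE (negbTE Si) Mi /=; move: vS; rewrite c1; lia.
  split=> //=; exists S', c; split=> //=.
  + by split=> //; do ?[exact: env_reg | exact: agree_upd].
  + by move=> l il; apply: S'S; apply: ltnW.
  + rewrite !valueS placeS S'S //; move: ncM vS.
    by case: (c); case: ((arr 3) i) => //= _; lia.
- move=> s' [S' [c [[Es' SM' A] _ e14 _ vS]]]; by exists S', c.
Qed.

(** * Testing a single subset *)

Definition half_dominated (arr : nat -> pred nat) i :=
  ~~ arr 0 i && ((arr 1 i || arr 2 i) && ~~ (arr 1 i && arr 2 i)).

(** Here [d] says that [i] has a neighbour in [S]. A row is bad if it violates independence or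
    leaves a one-sided vertex undominated, so a single scan computing [d] settles both
    conditions. *)
Definition bad_row arr (S : pred nat) i :=
  let d := has (fun j => adj i j && S j) (iota 0 n) in
  (S i && d) || (half_dominated arr i && ~~ d).

Definition good arr S := all (fun i => ~~ bad_row arr S i) (iota 0 n).

Lemma eq_good arr S T : (forall l, l < n -> S l = T l) -> good arr S = good arr T.
Proof.
move=> ST; apply: eq_in_all => i; rewrite mem_iota add0n => /andP[_ i_n].
rewrite /bad_row ST //.
have -> // : has (fun j => adj i j && S j) (iota 0 n) =
  has (fun j => adj i j && T j) (iota 0 n).
by apply: eq_in_has => j; rewrite mem_iota add0n => /andP[_ jn]; rewrite ST.
Qed.

Definition BadRow :=
  Or (And (Arr 4 1) (Reg 13))
     (And (And (Not (Arr 0 1)) (And (Or (Arr 1 1) (Arr 2 1))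
                                    (Not (And (Arr 1 1) (Arr 2 1)))))
          (Not (Reg 13))).

Definition TestSubset : cmd :=
  Seq (Assign 12 (Lit 1))
    (Rows (And Adj (Arr 4 2)) (If BadRow (Assign 12 (Lit 0)) Skip)).

Lemma run_test_subset arr s (S : pred nat) :
  env n adj (set_arr arr 4 S) s ->
  run TestSubset s (200 * n * n) (fun s' =>
    [/\ env n adj (set_arr arr 4 S) s', agree [:: 1; 2; 3; 12; 13] s s'
      & regs s' 12 = good arr S]).
Proof.
move=> Es; set arr' := set_arr arr 4 S in Es *.
set c := And Adj (Arr 4 2); set post := If BadRow (Assign 12 (Lit 0)) Skip.
apply: (@run_le _ _ (2 + (cost c + time post + 80) * n * n)); last by rewrite /=; nia.
apply: run_seq; apply: run_loop_free => //=.
pose J i s' := [/\ env n adj arr' s', agree [:: 1; 2; 3; 12; 13] s s'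
  & regs s' 12 = all (fun i => ~~ bad_row arr S i) (iota 0 i)].
apply: (@run_rows _ _ (fun=> arr') _ (fun i j => adj i j && S j) J) => //.
- by move=> i s' [].
- move=> i s1 s2 A Em [E1 A1 e12]; split.
  + exact: env_agree A _ Em E1.
  + move=> r hr; rewrite A ?A1 //; apply: contra hr; rewrite !inE.
    by do !case: eqP => //.
  + by rewrite A.
- move=> i j s' i_n jn _ Es' e1 e2 e3; apply: eval_and.
    exact: eval_adj Es' _ _ e3.
  exact: eval_arr Es' _ _ e2.
- move=> i s' i_n [_ A e12] Es' e1 e3 e13.
  have ar k : k < 5 -> eval s' (Arr k 1) = arr' k i.
    by move=> k5; apply: eval_arr Es' _ _ e1.
  have eB : eval s' BadRow = bad_row arr S i.
    apply: eval_or; first by apply: eval_and; [apply: ar|].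
    apply: eval_and; last exact: eval_not.
    apply: eval_and; first by apply/eval_not/ar.
    apply: eval_and; first by apply: eval_or; apply: ar.
    by apply/eval_not/eval_and; apply: ar.
  rewrite /post (effect_if _ _ eB).
  case: (boolP (bad_row arr S i)) => bi /=; split=> //; split.
  + exact: env_reg.
  + exact: agree_upd.
  + by rewrite all_iotaS bi andbF.
  + by [].
  + by [].
  + by rewrite all_iotaS (negbTE bi) andbT.
- by split=> //; do ?[exact: env_reg | exact: agree_upd].
Qed.

(** * Exhaustive search through the subsets *)

Definition Enum : cmd :=
  Seq (Assign 15 (Lit 1))
    (While (Reg 15)
      (Seq TestSubset
        (Seq (If (Reg 12) (Assign 11 (Lit 1)) Skip)
          (Seq Incr (Assign 15 (Not (Reg 14))))))).

Lemma run_enum arr s : arr 4 =1 xpred0 -> regs s 11 = 0 ->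
  env n adj arr s ->
  run Enum s (400 * place (arr 3) n * (n * n)) (fun s' => exists2 b : bool,
    regs s' 11 = b & (b <-> exists2 S, subpred S (arr 3) & good arr S)).
Proof.
move=> a4 e11 Es.
(* There are [m] subsets left to test, the current one included, and register 11 reports on those of
   smaller value. At [m = 0] the counter has wrapped around and register 11 reports on all. *)
pose J m s' := exists S : pred nat,
  [/\ env n adj (set_arr arr 4 S) s', subpred S (arr 3), regs s' 15 = (m != 0),
    m = 0 \/ m + value (arr 3) S n = place (arr 3) n
  & exists2 b : bool, regs s' 11 = b
    & (b <-> exists T, [/\ subpred T (arr 3), good arr T
                        & (m != 0) ==> (value (arr 3) T n < value (arr 3) S n)])].
have pl0 := place_gt0 (arr 3) n.
apply: (@run_le _ _
  (2 + (place (arr 3) n * (1 + (200 * n * n + (5 + (100 * n + 4)))).+1 + 2))); last by nia.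
apply: run_seq; apply: run_loop_free => //=.
apply: (@run_while _ _ _ J).
- move=> s' [S [_ _ e15 _ [b e11' hb]]]; split=> //; exists b => //.
  by rewrite hb; split=> [[T [? ? _]]|[T ? ?]]; exists T.
- move=> m s' [S [Es' SM e15 [//|vS] [b e11' hb]]]; split; first by rewrite /= e15.
  apply: run_seq_le (run_test_subset Es') _ (leqnn _) => s1 [Es1 A1 e12].
  apply: run_seq_le (leqnn _).
    apply: (@run_loop_free _ _ (fun s2 => [/\ env n adj (set_arr arr 4 S) s2
      & regs s2 11 = b || good arr S])) => //.
    rewrite (@effect_if (Reg 12) _ _ _ (good arr S)) //; case: ifPn => g; split=> //=.
    + exact: env_reg.
    + by move: g; case: (good _ _); rewrite // orbT.
    + by rewrite A1 // e11'; move: g; case: (good _ _); rewrite // orbF.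
  move=> s2 [Es2 e11'']; apply: run_seq_le (run_incr SM Es2) _ (leqnn _).
  move=> s3 [S' [c [Es3 SM' A3 e14 vS']]]; apply: run_loop_free => //=.
  have ltS' := value_lt (arr 3) S' n.
  have c0 : ~~ c = (m != 0).
    by move: vS'; case: (c) => /=; case: (m) vS => //=; lia.
  exists S'; split=> //.
  + exact: env_reg.
  + by rewrite /upd /= e14 -c0; case: (c).
  + by case: (m) c0 vS vS' => [|m']; [left|case: (c) => //= _; right; lia].
  + exists (b || good arr S); first by rewrite /upd /= A3.
    (* Without overflow the value of [S'] is one more than that of [S]; with overflow that of [S] is
       the largest. Either way the subsets now covered are those up to [S]. *)
    have lt T : (m != 0) ==> (value (arr 3) T n < value (arr 3) S' n) =
        (value (arr 3) T n <= value (arr 3) S n).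
      have ltT := value_lt (arr 3) T n.
      move: c0 vS'; case: (c) => /=; case: (m) vS => //= *; apply/esym; lia.
    split=> [/orP[/hb[T [TM gT lT]]|gS]|[T [TM gT]]].
    * by exists T; split=> //; rewrite lt ltnW.
    * by exists S; split=> //; rewrite lt.
    (* A subset of the same value as [S] agrees with [S] below [n], so it passes the same test. *)
    * rewrite lt leq_eqVlt => /orP[/eqP/(value_inj TM SM)/eq_good<-|lT].
        by rewrite gT orbT.
      by apply/orP; left; apply/hb; exists T.
- exists (arr 4); split=> //.
  + apply: env_reg => //; apply: env_ext Es => k i _.
    by rewrite /set_arr; case: eqP => // ->.
  + by move=> l; rewrite a4.
  + by rewrite -lt0n pl0.
  + by right; rewrite /value big1 ?addn0 // => l _; rewrite a4 andbF.
  + exists false => //; split=> // -[T [_ _]].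
    rewrite -lt0n pl0 /= [X in _ < X]/value big1 // => l _.
    by rewrite a4 andbF.
Qed.

End Env.

(** * The program *)

(** The product [n * n] is built in register 4 by repeated addition, the machine having no
    multiplication. *)
Definition Setup : cmd :=
  Seq (For 1 (Assign 4 (Plus (Reg 4) (Reg 0))))
    (Seq (Assign 5 (Plus (Reg 4) (Reg 0)))
    (Seq (Assign 6 (Plus (Reg 5) (Reg 0)))
    (Seq (Assign 7 (Plus (Reg 6) (Reg 0)))
         (Assign 8 (Plus (Reg 7) (Reg 0)))))).

(* Looks for a vertex of B with a neighbour in B; its row address goes to
   register 9 and register 10 records success. *)
Definition FindEdge : cmd :=
  Rows (And Adj (And (Arr 0 1) (Arr 0 2)))
    (If (Reg 13) (Seq (Assign 9 (Minus (Reg 3) (Reg 0))) (Assign 10 (Lit 1))) Skip).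

(* With v the vertex found, B :&: N(v) is one part of the bipartition and
   B :\: N(v) the other: arrays 1 and 2 become their neighbourhoods, and array 3
   the set of vertices at distance two from B. *)
Definition Search : cmd :=
  Seq (Mark 2 (And Adj (And (Arr 0 2) (Cell (Plus (Reg 9) (Reg 2))))))
    (Seq (Mark 1 (And Adj (And (Arr 0 2) (Not (Cell (Plus (Reg 9) (Reg 2)))))))
      (Seq (Mark 3 (And Adj (And (Not (Or (Arr 1 1) (Arr 2 1))) (Or (Arr 1 2) (Arr 2 2)))))
        Enum)).

(** Without an edge inside [B] some part is empty, and the answer 1 is given without a search. *)
Definition Decide : cmd :=
  Seq Setup (Seq FindEdge
    (Seq (If (Reg 10) Search (Assign 11 (Lit 1))) (Assign 0 (Reg 11)))).

Section Program.

Context (n : nat) (adj : rel nat).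
Hypothesis n0 : 0 < n.
Implicit Types (arr : nat -> nat -> bool) (s : state).

Lemma run_setup s arr : regs s 0 = n -> (forall r, 0 < r -> regs s r = 0) ->
  (forall i j, i < n -> j < n -> cells s (i * n + j) = adj i j) ->
  (forall k i, i < n -> cells s (n * n + k * n + i) = arr k i) ->
  run Setup s (100 * n) (fun s' => [/\ env n adj arr s', regs s' 10 = 0 & regs s' 11 = 0]).
Proof.
move=> e0 er ea eb.
pose I i s' := [/\ regs s' 0 = n, regs s' 1 = i, regs s' 4 = i * n, cells s' = cells s
  & regs s' 10 = 0 /\ regs s' 11 = 0].
apply: (@run_seq_le _ _ _ _ 16 _ (I n)).
- apply: (@run_for 1 _ 4 n I) => //.
  + by split=> //=; rewrite /upd /= !er.
  + by move=> i s' [].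
  + move=> i s' i_n [h0 h1 h4 hm [h10 h11]]; apply: run_loop_free => //=; split=> //.
    by split=> //=; rewrite /upd /= h0 h4 mulSn addnC.
- move=> s' [h0 h1 h4 hm [h10 h11]]; apply: run_loop_free => //=; split=> //.
  split=> //=; rewrite ?hm // => -[|[|[|[|[|k]]]]] // _; rewrite /upd /= ?h0 h4; lia.
- by nia.
Qed.

Lemma run_find_edge arr s
    (q := fun i j => adj i j && (arr 0 i && arr 0 j)) :
  env n adj arr s -> regs s 10 = 0 -> regs s 11 = 0 ->
  run FindEdge s (200 * n * n) (fun s' => [/\ env n adj arr s', regs s' 11 = 0
    & exists found : bool, [/\ regs s' 10 = found,
        found -> exists2 v, v < n & regs s' 9 = v * n /\ has (q v) (iota 0 n)
      & ~~ found -> forall v, v < n -> ~~ has (q v) (iota 0 n)]]).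
Proof.
move=> Es e10 e11.
pose J i s' := [/\ env n adj arr s', regs s' 11 = 0
    & exists found : bool, [/\ regs s' 10 = found,
        found -> exists2 v, v < n & regs s' 9 = v * n /\ has (q v) (iota 0 n)
      & ~~ found -> forall v, v < i -> ~~ has (q v) (iota 0 n)]].
rewrite /FindEdge; set c := And _ _; set post := If _ _ _.
apply: (@run_le _ _ ((cost c + time post + 80) * n * n)); last by rewrite /=; nia.
apply: (@run_rows n adj n0 _ _ (fun=> arr) _ q J) => //.
- by move=> i s' [].
- move=> i s1 s2 A Em [E1 e11' h]; split; rewrite ?A //.
  exact: env_agree A _ Em E1.
- move=> i j s' i_n jn _ Es' e1 e2 e3; apply: eval_and.
    exact: eval_adj Es' _ _ e3.
  by apply: eval_and; [apply: eval_arr Es' _ _ e1 | apply: eval_arr Es' _ _ e2].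
- move=> i s' i_n [_ e11' [found [ef hf hn]]] Es' e1 e3 e13.
  have en : regs s' 0 = n by case: Es'.
  rewrite /post (@effect_if (Reg 13) _ _ _ (has (q i) (iota 0 n))) //.
  case: ifPn => hq; split=> //; split=> //=.
  + by do 2!apply: env_reg => //.
  + exists true; split=> // _; exists i => //; split=> //.
    (* After the scan register 3 points to the following row; subtracting [n] recovers the start of
       row [i]. *)
    by rewrite /upd /= e3 en mulSn addnC addnK.
  + exists found; split=> // nf v; rewrite ltnS leq_eqVlt => /orP[/eqP->//|].
    exact: hn.
- by split=> //; exists false.
Qed.

Lemma run_search arr s v (B := arr 0)
    (a2 := fun i => has (fun j => adj i j && (B j && adj v j)) (iota 0 n))
    (a1 := fun i => has (fun j => adj i j && (B j && ~~ adj v j)) (iota 0 n))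
    (a3 := fun i => has (fun j => adj i j && (~~ (a1 i || a2 i) && (a1 j || a2 j))) (iota 0 n))
    (arr' := set_arr (set_arr (set_arr arr 2 a2) 1 a1) 3 a3) :
  v < n -> arr 4 =1 xpred0 -> env n adj arr s -> regs s 11 = 0 -> regs s 9 = v * n ->
  run Search s (1000 * place (arr' 3) n * (n * n)) (fun s' => exists2 b : bool,
    regs s' 11 = b & (b <-> exists2 S, subpred S (arr' 3) & good n adj arr' S)).
Proof.
move=> vn a4 Es e11 e9.
have hv arr1 s1 j : env n adj arr1 s1 -> regs s1 9 = v * n -> j < n ->
    regs s1 2 = j -> eval s1 (Cell (Plus (Reg 9) (Reg 2))) = adj v j.
  by move=> [_ _ ea _] E9 jn E2; rewrite /= E9 E2 ea.
(* Since [place] is positive, each of the three marking passes fits into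
   [200 * place (arr' 3) n * (n * n)], which leaves 400 for the enumeration. *)
have pl0 := place_gt0 (arr' 3) n.
apply: (@run_seq_le _ _ _ _ (800 * place (arr' 3) n * (n * n))); [| |].
- apply: (@run_mark n adj n0 2 _ _ _ (fun i j => adj i j && (B j && adj v j)) isT Es).
  move=> i j f s' i_n jn Es' A e1 e2 e3; apply: eval_and.
    exact: eval_adj Es' _ _ e3.
  apply: eval_and; last by apply: hv Es' _ jn e2; rewrite A.
  exact: eval_arr Es' _ _ e2.
- move=> s1 [Es1 A1]; apply: (@run_seq_le _ _ _ _ (600 * place (arr' 3) n * (n * n))); [| |].
  + apply: (@run_mark n adj n0 1 _ _ _ (fun i j => adj i j && (B j && ~~ adj v j)) isT Es1).
    move=> i j f s' i_n jn Es' A e1 e2 e3; apply: eval_and.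
      exact: eval_adj Es' _ _ e3.
    apply: eval_and; last first.
      by apply: eval_not; apply: hv Es' _ jn e2; rewrite A ?A1.
    exact: eval_arr Es' _ _ e2.
  + move=> s2 [Es2 A2]; apply: (@run_seq_le _ _ _ _ (400 * place (arr' 3) n * (n * n))); [| |].
    * apply: (@run_mark n adj n0 3 _ _ _ (fun i j =>
        adj i j && (~~ (a1 i || a2 i) && (a1 j || a2 j))) isT Es2).
      move=> i j f s' i_n jn Es' A e1 e2 e3; apply: eval_and.
        exact: eval_adj Es' _ _ e3.
      apply: eval_and.
        apply/eval_not/eval_or; [exact: eval_arr Es' _ _ e1 | exact: eval_arr Es' _ _ e1].
      by apply: eval_or; [exact: eval_arr Es' _ _ e2 | exact: eval_arr Es' _ _ e2].
    * move=> s3 [Es3 A3]; apply: run_enum Es3 => //.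
      by rewrite A3 // A2 // A1.
    * by rewrite /=; nia.
  + by rewrite /=; nia.
- by rewrite /=; nia.
Qed.

End Program.

Lemma nth_allpairs (S T : Type) (f : S -> T -> nat) x y s t i j :
  i < size s -> j < size t ->
  nth 0 [seq f a b | a <- s, b <- t] (i * size t + j) = f (nth x s i) (nth y t j).
Proof.
move=> + jt; elim: s i => [//|a s IHs] [|i] /= it; rewrite nth_cat size_map.
  by rewrite mul0n jt (nth_map y).
rewrite ifN ?mulSn -?addnA ?ltnNge ?leq_addr ?negbK //.
by rewrite addnC addnK IHs.
Qed.

(** * Correctness of the program *)

Section Glue.

Context (m : nat) (n := m.+1) (e : rel 'I_n).
Hypothesis sym : symmetric e.
Hypothesis irr : irreflexive e.
Let adj : rel nat := fun i j => e (inord i) (inord j).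

Lemma has_ord (q : pred nat) : has q (iota 0 n) = [exists j : 'I_n, q j].
Proof.
apply/hasP/existsP => [[j]|[j qj]].
  by rewrite mem_iota => /andP[_ jn] qj; exists (Ordinal (jn : j < n)).
by exists (j : nat) => //; rewrite mem_iota add0n ltn_ord.
Qed.

Lemma has_hood (A : {set 'I_n}) (q : pred nat) i :
  (forall j : 'I_n, q j = (j \in A)) ->
  has (fun j => adj i j && q j) (iota 0 n) = (inord i \in hood e A).
Proof.
move=> qA; rewrite has_ord; apply/existsP/hoodP => -[j].
  by rewrite /adj inord_val qA => /andP[eij jA]; exists j.
by move=> jA eij; exists j; rewrite /adj inord_val qA eij.
Qed.

(** By [disjoint_hood] independence is a condition on single vertices, like domination, so the two
    can be compared with [bad_row] row by row. *)
Lemma goodE (arr : nat -> pred nat) (S : pred nat) (X Y T : {set 'I_n}) :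
  (forall i : 'I_n, [/\ arr 0 i = (i \in X :|: Y), arr 1 i = (i \in hood e X)
                      & arr 2 i = (i \in hood e Y)]) ->
  (forall i : 'I_n, S i = (i \in T)) ->
  good n adj arr S = independent e T && (one_sided e X Y \subset hood e T).
Proof.
move=> arrE ST; rewrite disjoint_hood.
have row (i : 'I_n) : bad_row n adj arr S i =
    (i \in T) && (i \in hood e T) || (i \in one_sided e X Y) && (i \notin hood e T).
  rewrite /bad_row (has_hood _ ST) inord_val ST /half_dominated.
  have [-> -> ->] := arrE i.
  have -> : (i \in one_sided e X Y) =
      (i \notin X :|: Y) && ((i \in hood e X) (+) (i \in hood e Y)) by rewrite in_set.
  by case: (i \in hood e X); case: (i \in hood e Y).
have -> : good n adj arr S = ~~ has (bad_row n adj arr S) (iota 0 n).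
  by rewrite /good -all_predC.
rewrite has_ord negb_exists; apply/forallP/andP => [h|[/pred0P hT /subsetP hD] i].
  split; first apply/pred0P=> i /=; last (apply/subsetP=> i iD).
    by move: (h i); rewrite row negb_or => /andP[/negbTE].
  by move: (h i); rewrite row negb_or iD negbK => /andP[].
rewrite row negb_or; move: (hT i) => /= ->.
by rewrite negb_and negbK /= -implybE; apply/implyP/hD.
Qed.

Lemma exists_good (arr : nat -> pred nat) (X Y : {set 'I_n}) :
  (forall i : 'I_n, [/\ arr 0 i = (i \in X :|: Y), arr 1 i = (i \in hood e X)
                      & arr 2 i = (i \in hood e Y)]) ->
  (forall i : 'I_n, arr 3 i = (i \in shell e (X :|: Y))) ->
  (exists2 S, subpred S (arr 3) & good n adj arr S) <->
  [exists S : {set 'I_n}, [&& S \subset shell e (X :|: Y), independent e S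
                         & one_sided e X Y \subset hood e S]].
Proof.
move=> arrE shE; split=> [[S S3 gS]|/existsP[T /and3P[Tsh iT dT]]].
  apply/existsP; exists [set x : 'I_n | S x].
  rewrite -(@goodE arr S) ?gS ?andbT // => [|i]; last by rewrite inE.
  by apply/subsetP=> x; rewrite inE -shE; apply: S3.
(* The cut at [n] is needed for [subpred], as [arr 3] is known only below [n]. *)
exists (fun l => (l < n) && (inord l \in T)).
  by move=> l /andP[ln /(subsetP Tsh)]; rewrite -shE inordK.
by rewrite (@goodE arr _ X Y T) ?iT // => i; rewrite ltn_ord inord_val.
Qed.

Lemma place_card (M : pred nat) (A : {set 'I_n}) :
  (forall i : 'I_n, M i = (i \in A)) -> place M n = 2 ^ #|A|.
Proof.
move=> MA; rewrite /place -sum1_card [in RHS]big_mkcond /=; congr (2 ^ _).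
by apply: eq_bigr => i _; rewrite MA; case: (i \in A).
Qed.

Lemma initial_env (B : {set 'I_n}) (s := initial_state e B) :
  [/\ regs s 0 = n, forall r, 0 < r -> regs s r = 0,
      forall i j, i < n -> j < n -> cells s (i * n + j) = adj i j
    & forall k i, i < n -> cells s (n * n + k * n + i) = (k == 0) && (inord i \in B)].
Proof.
set l1 := [seq nat_of_bool (e i j) | i <- enum 'I_n, j <- enum 'I_n].
have sz1 : size l1 = n * n by rewrite size_allpairs size_enum_ord.
split=> //.
- by case.
- move=> i j i_n jn /=; rewrite nth_cat -/l1 sz1.
  rewrite ifT; last first.
    have : i.+1 * n <= n * n by rewrite leq_mul2r i_n orbT.
    by rewrite mulSn; lia.
  rewrite -[X in _ * X + _](size_enum_ord n).
  rewrite (nth_allpairs _ (inord i) (inord j)) ?size_enum_ord //.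
  have E (a : nat) z : a < n -> nth z (enum 'I_n) a = inord a.
    by move=> an; rewrite -[a in LHS](inordK an) nth_ord_enum.
  by rewrite !E.
move=> k i i_n /=; rewrite nth_cat -/l1 sz1 ifN; last by rewrite -leqNgt; lia.
have -> : n * n + k * n + i - n * n = k * n + i by lia.
case: k => [|k] /=.
  rewrite (nth_map (inord i)) ?size_enum_ord // -[X in nth _ _ X](inordK i_n).
  by rewrite nth_ord_enum.
(* Beyond the input [nth] returns its default 0, so all arrays but the first start empty. *)
by rewrite nth_default // size_map size_enum_ord mulSn; lia.
Qed.

Lemma run_decide (BX BY : {set 'I_n}) :
  induced_complete_bipartite e BX BY ->
  run Decide (initial_state e (BX :|: BY))
    (2000 * (2 ^ (2 * max_degree e ^ 3)) * (n * n))
    (fun s => regs s 0 = generating e BX BY).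
Proof.
move=> XY; have n0 : 0 < n by [].
set N := 2 ^ _; have N0 : 0 < N by rewrite expn_gt0.
set B := BX :|: BY.
have [i0 ir ia ib] := initial_env B.
pose arr k i := (k == 0) && (inord i \in B).
have setup := run_setup n0 i0 ir ia (arr := arr) ib.
apply: (run_seq_le setup (t2 := 1800 * N * (n * n))) => [s1 [E1 e10 e11]|]; last by nia.
apply: (run_seq_le (run_find_edge n0 E1 e10 e11) (t2 := 1400 * N * (n * n))); last by nia.
move=> s2 [E2 e11' [found [ef hf hn]]].
apply: (@run_seq_le _ _ _ (1300 * N * (n * n)) 2 _
  (fun s => regs s 11 = generating e BX BY)); [|by move=> s h; apply: run_loop_free|by nia].
apply: (@run_le _ _ (1 + 1200 * N * (n * n)).+1); last by nia.
have arr0 (i : 'I_n) : arr 0 i = (i \in B) by rewrite /arr inord_val.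
have /and4P[_ /independentP iX /independentP iY _] := XY.
apply: (@run_if (Reg 10) found) => // hfound; last first.
  apply: (@run_le _ _ 2); last by nia.
  apply: run_loop_free => //=; rewrite /upd /=.
  suff -> : generating e BX BY by [].
  have [-> | [x xX]] := set_0Vmem BX.
    by apply: generating_empty => //; apply/independentP.
  have [-> | [y yY]] := set_0Vmem BY.
    by rewrite generatingC; apply: generating_empty => //; apply/independentP.
  have /negP[] := hn hfound x (ltn_ord x).
  rewrite has_ord; apply/existsP; exists y.
  by rewrite /adj !inord_val !arr0 !inE xX yY orbT (bipartite_adj XY).
have [v vn [e9 hv]] := hf hfound.
pose w : 'I_n := Ordinal vn.
have adjw (j : 'I_n) : adj v j = e w j.
  by rewrite /adj inord_val; congr e; apply: val_inj; rewrite /= inordK.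
have {hv} [u [ewu wB uB]] : exists u, [/\ e w u, w \in B & u \in B].
  move: hv; rewrite has_ord => /existsP[u /and3P[vu vB uB]]; exists u.
  by rewrite -adjw -!arr0.
pose Y := [set j in B | e w j]; pose X := [set j in B | ~~ e w j].
have [XY' X0 Y0 gXY] : [/\ induced_complete_bipartite e X Y, X != set0, Y != set0
    & generating e X Y = generating e BX BY].
  have X0 : X != set0 by apply/set0Pn; exists w; rewrite inE wB irr.
  have Y0 : Y != set0 by apply/set0Pn; exists u; rewrite inE uB ewu.
  (* The part [U] containing [w] is independent and [w] is adjacent to all of [V], so the neighbours
     of [w] in [B] are exactly [V]. Which given part contains [w] does not matter, by
     [generatingC]. *)
  have main U V : induced_complete_bipartite e U V -> U :|: V = B -> w \in U -> X = U /\ Y = V.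
    move=> UV UVB wU.
    have /and4P[/pred0P dUV /independentP iU _ _] := UV.
    have ew j : j \in B -> e w j = (j \in V) /\ ~~ e w j = (j \in U).
      rewrite -UVB => /setUP[jU|jV].
        have jV : j \in V = false by move: (dUV j); rewrite /= jU.
        by rewrite jV jU iU // (negbTE (iU _ _ wU jU)).
      have jU : j \in U = false by move: (dUV j); rewrite /= jV andbT.
      by rewrite jV jU (bipartite_adj UV).
    split; apply/setP=> j; rewrite inE; case: (boolP (j \in B)) => jB /=.
    + by case: (ew j jB).
    + by apply/esym/negbTE; apply: contra jB; rewrite -UVB inE => ->.
    + by case: (ew j jB).
    + by apply/esym/negbTE; apply: contra jB; rewrite -UVB inE orbC => ->.
  case/setUP: (wB) => [wX|wY].
    by have [EX EY] := main BX BY XY erefl wX; rewrite EX EY in X0 Y0 *.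
  have YX : induced_complete_bipartite e BY BX.
    case/and4P: XY => d iX' iY' /forall_inP c; apply/and4P; split=> //.
      by rewrite disjoint_sym.
    apply/forall_inP=> y yY; apply/forall_inP=> x xX; rewrite sym.
    by move/forall_inP: (c x xX); apply.
  have [EX EY] := main BY BX YX (setUC _ _) wY.
  by rewrite EX EY generatingC in X0 Y0 *.
have XYB : X :|: Y = B.
  by apply/setP=> j; rewrite !inE -andb_orr orNb andbT.
have a4 : arr 4 =1 xpred0 by [].
pose a2 i := has (fun j => adj i j && (arr 0 j && adj v j)) (iota 0 n).
pose a1 i := has (fun j => adj i j && (arr 0 j && ~~ adj v j)) (iota 0 n).
pose a3 i := has (fun j => adj i j && (~~ (a1 i || a2 i) && (a1 j || a2 j))) (iota 0 n).
pose arr' := set_arr (set_arr (set_arr arr 2 a2) 1 a1) 3 a3.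
have search : run Search s2 (1000 * place (arr' 3) n * (n * n)) (fun s' =>
    exists2 b : bool, regs s' 11 = b
    & (b <-> exists2 S, subpred S (arr' 3) & good n adj arr' S)).
  exact: run_search.
have a2E i : a2 i = (inord i \in hood e Y).
  by apply: (@has_hood Y (fun j => arr 0 j && adj v j)) => j; rewrite arr0 adjw [RHS]in_set.
have a1E i : a1 i = (inord i \in hood e X).
  by apply: (@has_hood X (fun j => arr 0 j && ~~ adj v j)) => j; rewrite arr0 adjw [RHS]in_set.
have arrE (i : 'I_n) : [/\ arr' 0 i = (i \in X :|: Y), arr' 1 i = (i \in hood e X)
                      & arr' 2 i = (i \in hood e Y)].
  rewrite XYB; split; first exact: arr0.
    by have := a1E i; rewrite inord_val; apply.
  by have := a2E i; rewrite inord_val; apply.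
have a12 j : a1 j || a2 j = (inord j \in hood e (X :|: Y)).
  by rewrite a1E a2E hoodU in_setU.
have shE (i : 'I_n) : arr' 3 i = (i \in shell e (X :|: Y)).
  rewrite /arr' /set_arr /= /a3 in_setD.
  have -> : (i \notin hood e (X :|: Y)) = ~~ (a1 i || a2 i) by rewrite a12 inord_val.
  case: (a1 i || a2 i).
    by apply/negbTE/hasPn=> j _; rewrite andbF.
  rewrite -[in RHS](inord_val i); apply: has_hood => j.
  by rewrite a12 inord_val.
apply: run_weaken search _ _.
  (* The number of subsets enumerated is 2 to the size of the shell, which [card_shell] bounds. *)
  rewrite (place_card shE) leq_mul2r; apply/orP; right.
  apply: leq_mul => //; rewrite leq_exp2l //.
  by apply: card_shell.
move=> s [b -> hb]; congr nat_of_bool; rewrite -gXY (generatingE sym irr XY' X0 Y0).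
by apply/idP/idP => [/hb/(exists_good arrE shE)|/(exists_good arrE shE)/hb].
Qed.

End Glue.

Theorem theorem7 (R : realType) (k : nat) (hk : 0 < k) :
  exists (P : cmd) (C : nat),
    forall (n : nat) (e : rel 'I_n) (BX BY : {set 'I_n}),
      0 < n ->
      symmetric e -> irreflexive e ->
      ((max_degree e)%:R <= k%:R * log2 (n%:R : R) `^ (1 / 3))%R ->
      induced_complete_bipartite e BX BY ->
      exists (s : state) (t : nat),
        [/\ exec P (initial_state e (BX :|: BY)) s t,
            regs s 0 = nat_of_bool (generating e BX BY)
          & t <= C * n ^ (2 + 2 * k ^ 3)].
Proof.
(* One program and one constant serve every [k]; the degree hypothesis enters only when
   [exp2_degree_bound] turns the number of subsets into a power of [n]. *)
exists Decide, 2000; case=> // m e BX BY n0 sym irr deg XY.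
have [s [t [E le h]]] := run_decide sym irr XY.
exists s, t; split=> //; apply: leq_trans le _.
rewrite -mulnA leq_pmul2l // mulnC expnD leq_pmul2l ?expn_gt0 //.
exact: exp2_degree_bound deg.
Qed.
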